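(* Let $n$ and $r$ be positive integers, let $G$ be the circulant graph $C_n^{1,2,\dots,r}$, and denote by $mc(G)$ the value of the maximum cut of $G$. Then $mc(G)\le\left(\frac{5r}{8}+76\right)n$.
   Context: The circulant graph $C_n^{1,2,\dots,r}$ is the undirected graph with $n$ nodes labeled $0,\dots,n-1$ where each node $i$ is adjacent to the $2r$ nodes $i\pm 1, i\pm 2,\dots,i\pm r \pmod n$. The value of the maximum cut $mc(G)$ is the maximum, over all bipartitions of the node set into two parts, of the number of edges with endpoints in different parts (equivalently, the maximum number of edges of a bipartite subgraph of $G$). *)

(* Defs.v *)
From mathcomp Require Import all_boot all_order all_algebra.

Set Implicit Arguments.
Unset Strict Implicit.
Unset Printing Implicit Defensive.

(* A finite simple graph is given by a symmetric irreflexive relation on its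
   nodes; its edges are the two-element sets of adjacent nodes. *)
Section MaxCut.
Variables (T : finType) (e : rel T).

Definition edges : {set {set T}} :=
  [set E : {set T} | [exists x, exists y, e x y && (E == [set x; y])]].

Definition cut (A : {set T}) : {set {set T}} :=
  [set E in edges | [exists x in A, exists y in ~: A, E == [set x; y]]].

Definition maxcut : nat := \max_(A : {set T}) #|cut A|.

End MaxCut.

(* The circulant graph C_n^{1,...,r}.  The clause [i != j] only matters when
   n <= r, where i + n = i %[mod n] would otherwise create loops. *)
Definition circulant (n r : nat) : rel 'I_n := fun i j =>
  (i != j) &&
  [exists k : 'I_r.+1, (0 < k) &&
    ((j == i + k %[mod n]) || (j + k == i %[mod n]))].

Lemma circulant_irrefl n r : irreflexive (@circulant n r).
Proof. by move=> i; rewrite /circulant eqxx. Qed.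

Lemma circulant_sym n r : symmetric (@circulant n r).
Proof.
move=> i j; rewrite /circulant eq_sym; congr (_ && _).
by apply: eq_existsb => k; rewrite orbC ![(_ %% _ == (_ + _) %% _)]eq_sym.
Qed.

(* Main.v *)
Require Import Defs.
From mathcomp Require Import all_boot all_order all_algebra.
From mathcomp Require Import ring lra zify.
Import Order.TTheory GRing.Theory Num.Theory.
Local Open Scope ring_scope.

(** Colour the nodes by +1 and -1 according to their side of the cut and read
the colouring as an n-periodic sequence x.  With the autocorrelations
c(d) = sum_i x_i x_(i+d), each d in 1..r contributes (n - c(d)) / 2
bichromatic pairs, so what is needed is a lower bound of about - r n / 4 for
c(1) + ... + c(r) ([card_cut_le], [corr_sum_ge]).

The lower bound comes from the fact that a complete graph on m nodes cannot be
cut much better than half: for points y_1, ..., y_m of [-s, s], the sum of the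
products of pairs is at least - floor(m/2) s^2, being affine in each variable
and hence minimal at a vertex of the cube ([sum_pairs_ge]).  The
loss floor(m/2) is spread over m (m - 1) / 2 pairs, so larger m is better;
m = 7 loses 3 for 21 pairs.

Apply this to complete graphs placed along the cycle.  Let s = floor(r / 27),
let y_i be the sum of the s consecutive entries x_i, ..., x_(i+s-1), and place
copies of rulers at the multiples of s.  The marks 0, 1, 5, 15, 17, 23, 26
have 21 distinct differences; among the other five numbers up to 26 there are
7 + 13 = 20, a triangle, and the two leftovers 19 and 24 are treated as single
edges.  Thus every difference 1, ..., 26 is measured exactly once
([rulers_diffs]), with total loss 3 + 1 + 1 + 1 = 6, and averaging over all
positions gives sum_(k = 1..26) sum_i y_i y_(i+ks) >= - 6 s^2 n
([block_corr_sum_ge]).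

Expanding the blocks returns to x: in a window of length 27 s, the pairs whose
left end lies in the first block are the pairs inside this block, whose
products sum to at least - s / 2 because their double is a square minus s,
and the pairs joining the first block to the 26 following ones
([window_corr]).  The entry at position l of the first block sees the
differences 1, ..., 27 s - 1 - l.  Completing these to 1, ..., r costs at most
(l + O(1)) n for this l, that is s^2 n / 2 + O(s n) in total.  Altogether
c(1) + ... + c(r) >= - (6 + 1/2) s n - O(n), while r / 4 is at least
(6 + 3/4) s.  The slack s / 4 is what allows a ruler system that is not
perfect. *)

Set Implicit Arguments.
Unset Strict Implicit.
Unset Printing Implicit Defensive.

(** * Sums of products of pairs of bounded numbers *)

(** Let e_1, ..., e_m be independent signs such that s e_j has mean y_j.  The
right-hand side is the mean of the square of
(2 k + b) s + sum_j (s e_j + s), an integer multiple of s whose parity is that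
of b; hence the bound.  Shifting every sign by 1 makes its two values 0 and 2,
so that fixing one sign changes k only and never the parity b. *)
Lemma two_point_spread (k b s : int) (ys : seq int) :
    0 < s -> (b == 0) || (b == 1) -> all (fun y => `|y| <= s) ys ->
  b * s ^+ 2 <= ((2 * k + b) * s + \sum_(y <- ys) (y + s)) ^+ 2
                + \sum_(y <- ys) (s ^+ 2 - y ^+ 2).
Proof.
move=> s_gt0 b01; elim: ys k => [|y ys IH] k /=.
  rewrite !big_nil !addr0 exprMn => _; apply: ler_wpM2r; first exact: sqr_ge0.
  by case/orP: b01 => /eqP->; nia.
(* The claim is affine in the head y, so it is the convex combination with
   weights (s + y) / 2s and (s - y) / 2s of the cases y = s and y = - s. *)
case/andP=> ley /IH {}IH; rewrite !big_cons.
have := IH k; have := IH (k + 1).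
set S := \sum_(j <- ys) (j + s); set V := \sum_(j <- ys) _ => hi lo.
rewrite -(ler_pM2l (_ : 0 < 2 * s)) ?mulr_gt0 //.
have [hm hp] : 0 <= s - y /\ 0 <= s + y by lia.
have := lerD (ler_wpM2l hp hi) (ler_wpM2l hm lo).
by congr (_ <= _); ring.
Qed.

Fixpoint pairs (p : seq nat) : seq (nat * nat) :=
  if p is a :: p' then [seq (a, b) | b <- p'] ++ pairs p' else [::].

Lemma sum_sqr_pairs (Y : nat -> int) p :
  (\sum_(a <- p) Y a) ^+ 2
    = \sum_(a <- p) Y a ^+ 2 + 2 * \sum_(ab <- pairs p) Y ab.1 * Y ab.2.
Proof.
elim: p => [|a p IH] /=; first by rewrite !big_nil; ring.
rewrite !big_cons big_cat big_map /= -mulr_sumr sqrrD IH; ring.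
Qed.

(** In terms of graphs, a complete graph on m nodes has a cut that exceeds
half of its edges by at most floor(m/2) / 2, also fractionally. *)
Lemma sum_pairs_ge (Y : nat -> int) (s : int) p :
    0 < s -> (forall a, `|Y a| <= s) ->
  - ((size p)./2%:R * s ^+ 2) <= \sum_(ab <- pairs p) Y ab.1 * Y ab.2.
Proof.
move=> s_gt0 leY.
have b01 : ((odd (size p))%:R == 0 :> int) || ((odd (size p))%:R == 1 :> int).
  by case: odd.
have allY : all (fun y => `|y| <= s) (map Y p).
  by apply/allP=> y /mapP[a _ ->].
(* This value of k makes (2 k + b) s cancel the shifts by s of all entries. *)
have := two_point_spread (- ((size p)./2%:R + (odd (size p))%:R)) s_gt0 b01 allY.
rewrite !big_map sumrB big_split /=.
have -> : (\sum_(i <- p) s = (size p)%:R * s).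
  by rewrite big_const_seq count_predT iter_addr_0 mulr_natl.
have -> : (\sum_(i <- p) s ^+ 2 = (size p)%:R * s ^+ 2).
  by rewrite big_const_seq count_predT iter_addr_0 mulr_natl.
have -> : (size p)%:R = (odd (size p))%:R + 2 * (size p)./2%:R :> int.
  by rewrite -{1}[size p]odd_double_half; lia.
move=> h; have := sum_sqr_pairs Y p; move: h.
set S := \sum_(i <- p) Y i; set E := \sum_(ab <- pairs p) _.
set Q := \sum_(i <- p) Y i ^+ 2.
set o := (odd _)%:R; set h := (size p)./2%:R.
have -> : (2 * - (h + o) + o) * s + (S + (o + 2 * h) * s) = S by ring.
lra.
Qed.

(** * Autocorrelations and block sums *)

Lemma sum_periodic_shift (n : nat) (f : nat -> int) d :
    (forall i, f (i + n)%N = f i) ->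
  \sum_(0 <= i < n) f (i + d)%N = \sum_(0 <= i < n) f i.
Proof.
move=> per; elim: d => [|d <-]; first by under eq_bigr do rewrite addn0.
case: n per => [|n] per; first by rewrite !big_geq.
rewrite big_nat_recr //= [RHS]big_nat_recl //= addrC -addSnnS addnC per add0n.
by congr (_ + _); apply: eq_bigr => i _; rewrite addSnnS.
Qed.

Definition corr (n : nat) (x : nat -> int) (d : nat) : int :=
  \sum_(0 <= i < n) x i * x (i + d)%N.

Definition block (s : nat) (x : nat -> int) (i : nat) : int :=
  \sum_(0 <= l < s) x (i + l)%N.

Lemma corr_shift n x a b : (forall i, x (i + n)%N = x i) -> (a <= b)%N ->
  \sum_(0 <= i < n) x (i + a)%N * x (i + b)%N = corr n x (b - a).
Proof.
move=> per leab; rewrite /corr -[RHS](sum_periodic_shift a).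
  by apply: eq_bigr => i _; rewrite -addnA subnKC.
by move=> i; rewrite per addnAC per.
Qed.

Lemma corr_le n x (M : int) d : (forall i, `|x i| <= M) ->
  `|corr n x d| <= M ^+ 2 * n%:R.
Proof.
move=> leM; apply: le_trans (ler_norm_sum _ _ _) _.
have -> : M ^+ 2 * n%:R = \sum_(0 <= i < n) M ^+ 2.
  by rewrite sumr_const_nat subn0 mulr_natr.
by apply: ler_sum => i _; rewrite normrM expr2 ler_pM.
Qed.

Lemma block_le s x i : (forall j, `|x j| <= 1) -> `|block s x i| <= s%:R.
Proof.
move=> le1; apply: le_trans (ler_norm_sum _ _ _) _.
have -> : s%:R = \sum_(0 <= l < s) (1 : int) by rewrite sumr_const_nat subn0.
exact: ler_sum.
Qed.

Lemma blocks_cat s x i t :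
  \sum_(s <= m < t.+1 * s) x (i + m)%N
    = \sum_(1 <= k < t.+1) block s x (i + k * s).
Proof.
elim: t => [|t IH]; first by rewrite mul1n !big_geq.
rewrite big_nat_recr //= -IH (big_cat_nat _ (n := t.+1 * s)) ?leq_pmull //=.
  congr (_ + _); rewrite -{1}[(t.+1 * s)%N]add0n big_addn.
  rewrite [(t.+2 * s)%N]mulSn addnK.
  by apply: eq_bigr => l _; rewrite -addnA [(l + _)%N]addnC.
by rewrite leq_mul2r leqnSn orbT.
Qed.

(** The pairs l < m with l in the initial segment of length s either lie in
that segment, where they complete the squares to the square of its sum, or
join the segment to the rest of the window. *)
Lemma window_sum (u : nat -> int) s T : (s <= T)%N ->
  2 * \sum_(0 <= l < s) \sum_(l.+1 <= m < T) u l * u m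
    = (\sum_(0 <= l < s) u l) ^+ 2 - \sum_(0 <= l < s) u l ^+ 2
      + 2 * (\sum_(0 <= l < s) u l) * \sum_(s <= m < T) u m.
Proof.
elim: s => [|s IH] lesT; first by rewrite !(big_geq (n := 0)) //; ring.
have := IH (ltnW lesT); rewrite !(big_nat_recr s) //= mulrDr => ->.
rewrite [\sum_(s <= _ < T) _]big_ltn // -mulr_sumr; ring.
Qed.

(** * A system of rulers measuring 1, ..., 26 *)

(** A ruler with m marks has loss floor(m/2), so this system has loss 6.  The
last half block completed in [corr_sum_ge] adds 1/2, and 13/2 must stay below
27/4, one quarter of the number of blocks.  Rulers with many marks are the
efficient ones, whence the Golomb ruler with seven marks. *)
Definition rulers : seq (seq nat) :=
  [:: [:: 0; 1; 5; 15; 17; 23; 26]; [:: 0; 7; 20]; [:: 0; 19]; [:: 0; 24]]%N.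

Lemma rulers_diffs :
  perm_eq [seq (ab.2 - ab.1)%N | ab <- flatten (map pairs rulers)] (iota 1 26).
Proof. by []. Qed.

Lemma block_corr_sum_ge n s x : (forall i, x (i + n)%N = x i) ->
    (forall i, `|x i| <= 1) -> (0 < s)%N ->
  - (6 * s%:R ^+ 2 * n%:R)
    <= \sum_(1 <= k < 27) corr n (block s x) (k * s).
Proof.
move=> per le1 s_gt0.
have perY i : block s x (i + n) = block s x i.
  by apply: eq_bigr => l _; rewrite addnAC per.
rewrite /index_iota subSS subn0 -(perm_big _ rulers_diffs) big_map.
under eq_big_seq => ab abP.
  have leab : (ab.1 <= ab.2)%N.
    by apply: (allP (_ : all (fun ab => ab.1 <= ab.2)%N _)) abP.
  rewrite mulnBl -(corr_shift perY) ?leq_mul2r ?leab ?orbT //.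
  over.
rewrite exchange_big.
have -> : - (6 * s%:R ^+ 2 * n%:R) = \sum_(0 <= i < n) - (6 * s%:R ^+ 2) :> int.
  by rewrite sumr_const_nat subn0 mulNrn mulr_natr.
apply: ler_sum => i _.
pose Y a := block s x (i + a * s).
have leY a : `|Y a| <= s%:R by apply: block_le.
rewrite big_flatten big_map /=.
have -> : - (6 * s%:R ^+ 2)
    = \sum_(p <- rulers) - ((size p)./2%:R * s%:R ^+ 2) :> int.
  by rewrite /rulers !big_cons big_nil /=; ring.
apply: ler_sum => p _; apply: (@sum_pairs_ge Y) => //.
by rewrite ltr0n.
Qed.

(** * The sum of the autocorrelations *)

(** Grouped by the position l of the left end in the first block, the pairs of
a window of 27 blocks are counted by the autocorrelations on the right. *)
Lemma window_corr n s x : (forall i, x (i + n)%N = x i) ->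
    (forall i, x i ^+ 2 = 1) ->
  2 * \sum_(1 <= k < 27) corr n (block s x) (k * s) - s%:R * n%:R
    <= 2 * \sum_(0 <= l < s) \sum_(1 <= d < 27 * s - l) corr n x d.
Proof.
move=> per sqr1.
have -> : \sum_(0 <= l < s) \sum_(1 <= d < 27 * s - l) corr n x d
    = \sum_(0 <= i < n) \sum_(0 <= l < s) \sum_(l.+1 <= m < 27 * s)
        x (i + l)%N * x (i + m)%N.
  rewrite [RHS]exchange_big; apply: eq_bigr => l _.
  rewrite [RHS]exchange_big -[l.+1]add1n big_addn /=.
  by apply: eq_bigr => d _; rewrite corr_shift ?leq_addl // addnK.
rewrite [\sum_(1 <= k < 27) _]exchange_big.
have -> : s%:R * n%:R = \sum_(0 <= i < n) (s%:R : int).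
  by rewrite sumr_const_nat subn0 mulr_natr.
rewrite !mulr_sumr -sumrB; apply: ler_sum => i _.
rewrite (window_sum (fun l => x (i + l)%N)) ?leq_pmull //.
rewrite (blocks_cat s x i 26) -mulr_sumr.
under [X in _ <= _ - X + _]eq_bigr do rewrite sqr1.
rewrite sumr_const_nat subn0 -/(block s x i).
have := sqr_ge0 (block s x i); lra.
Qed.

(** The entries x_l of the first block see differences up to 27 s - 1 - l, and their
shortfall against r = 27 s + e adds s^2 / 2 to the loss 6 s^2, and
13/2 is less than 27/4.  The constant 82 absorbs the terms linear in e. *)
Lemma corr_sum_ge n r x : (forall i, x (i + n)%N = x i) ->
    (forall i, x i ^+ 2 = 1) ->
  - ((r + 82)%:R * n%:R) <= 4 * \sum_(1 <= d < r.+1) corr n x d.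
Proof.
move=> per sqr1.
have le1 i : `|x i| <= 1 by have := sqr1 i; nia.
have tail a b : - ((b - a)%:R * n%:R) <= \sum_(a <= d < b) corr n x d.
  have -> : - ((b - a)%:R * n%:R) = \sum_(a <= d < b) - (n%:R : int).
    by rewrite sumr_const_nat mulNrn mulr_natl.
  apply: ler_sum => d _; have := corr_le n d le1.
  by rewrite expr1n mul1r ler_norml => /andP[].
pose s := (r %/ 27)%N; pose e := (r %% 27)%N.
have def_r : r = (27 * s + e)%N by rewrite mulnC -divn_eq.
have lt_e : (e < 27)%N by rewrite ltn_mod.
have [s0|s_gt0] := posnP s.
  (* Here r <= 26, and the trivial bound - r n suffices. *)
  have := tail 1%N r.+1; rewrite subSS subn0 => h.
  have -> : (r + 82)%:R = 4 * r%:R + (82 - 3 * r)%:R :> int by lia.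
  have : 0 <= (82 - 3 * r)%:R * n%:R :> int by rewrite mulr_ge0 ?ler0n.
  lra.
set R := \sum_(1 <= d < r.+1) _.
have step : \sum_(0 <= l < s) (\sum_(1 <= d < 27 * s - l) corr n x d
    - (e.+1 + l)%:R * n%:R) <= s%:R * R.
  have -> : s%:R * R = \sum_(0 <= l < s) R.
    by rewrite sumr_const_nat subn0 mulr_natl.
  rewrite !big_nat; apply: ler_sum => l /andP[_ lt_l].
  rewrite /R [leRHS](big_cat_nat _ (n := 27 * s - l)) /=; [|lia|lia].
  rewrite lerD2l; have := tail (27 * s - l)%N r.+1.
  by have -> : (r.+1 - (27 * s - l) = e.+1 + l)%N by lia.
move: step; rewrite sumrB -mulr_suml.
have gauss : 2 * (\sum_(0 <= l < s) (e.+1 + l)%:R)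
    = s%:R * (2 * e%:R + 1 + s%:R) :> int.
  elim: (s) => [|t IH]; first by rewrite big_geq //; ring.
  rewrite big_nat_recr //= mulrDr IH -[t.+1]addn1 -[e.+1]addn1 !natrD; ring.
have := window_corr s per sqr1; have := block_corr_sum_ge per le1 s_gt0.
set C := \sum_(1 <= k < 27) _; set W := \sum_(0 <= l < s) \sum_(_ <= d < _) _.
move: gauss; set G := \sum_(0 <= l < s) _ => gauss hC hW hR.
have s_gt0' : 0 < s%:R :> int by rewrite ltr0n.
have h2R : - ((13 * s%:R + 2 * e%:R + 2) * n%:R) <= 2 * R.
  rewrite -(ler_pM2l s_gt0').
  have hG : 2 * (G * n%:R) = s%:R * (2 * e%:R + 1 + s%:R) * n%:R.
    by rewrite mulrA gauss.
  lra.
have -> : (r + 82)%:R = 26 * s%:R + 4 * e%:R + 4 + (s + 78 - 3 * e)%:R :> int.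
  by lia.
have : 0 <= (s + 78 - 3 * e)%:R * n%:R :> int by rewrite mulr_ge0 ?ler0n.
lra.
Qed.

(** * Cuts of circulant graphs *)

Definition colour n (A : {set 'I_n.+1}) (i : nat) : int :=
  (-1) ^+ (inord (i %% n.+1) \in A).

Lemma colour_periodic n (A : {set 'I_n.+1}) i :
  colour A (i + n.+1) = colour A i.
Proof. by rewrite /colour modnDr. Qed.

Lemma colour_sqr n (A : {set 'I_n.+1}) i : colour A i ^+ 2 = 1.
Proof. exact: sqrr_sign. Qed.

(** Sending the pair (i, d) to {i, i + d} hits every cut edge from a pair with
ends of different colours.  When n <= 2 r an edge may be hit several times,
which only helps the inequality. *)
Lemma card_cut_le n r (A : {set 'I_n.+1}) :
  2 * #|cut (@circulant n.+1 r) A|%:R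
    <= r%:R * n.+1%:R - \sum_(1 <= d < r.+1) corr n.+1 (colour A) d.
Proof.
pose nxt (p : 'I_n.+1 * 'I_r) : 'I_n.+1 := inord ((p.1 + p.2.+1) %% n.+1).
pose B := [set p | (p.1 \in A) != (nxt p \in A)].
have cutB : cut (@circulant n.+1 r) A \subset
    [set [set p.1; nxt p] | p in B].
  apply/subsetP => E; rewrite !inE => /andP[/existsP[u /existsP[v]]].
  case/andP=> /andP[_ /existsP[k /andP[k_gt0 adj]]] /eqP->.
  case/existsP=> a /andP[aA /existsP[b /andP[bA /eqP defE]]].
  have sep : (u \in A) != (v \in A).
    apply/eqP=> same.
    have mono z : z \in [set u; v] -> (z \in A) = (u \in A).
      by case/set2P=> ->.
    by move: bA; rewrite inE mono ?defE ?set22 // -(mono a) ?defE ?set21 ?aA.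
  have lt_k : (k.-1 < r)%N by rewrite prednK // -ltnS.
  pose k' : 'I_r := Ordinal lt_k.
  have nxtE (i j : 'I_n.+1) : j = i + k %[mod n.+1] -> nxt (i, k') = j.
    by move=> eqm; rewrite /nxt /= prednK // -eqm modn_small // inord_val.
  case/orP: adj => /eqP adj; apply/imsetP.
    by exists (u, k'); rewrite ?inE /= (nxtE _ _ adj).
  exists (v, k'); rewrite ?inE /= (nxtE _ _ (esym adj)) 1?eq_sym //.
  by rewrite setUC.
have -> : r%:R * n.+1%:R - \sum_(1 <= d < r.+1) corr n.+1 (colour A) d
    = 2 * #|B|%:R :> int.
  have -> : #|B|%:R = \sum_(p : 'I_n.+1 * 'I_r)
      (((p.1 \in A) != (nxt p \in A))%:R : int).
    rewrite -sum1_card natr_sum big_mkcond /=.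
    by apply: eq_bigr => p _; rewrite inE; case: (_ != _).
  rewrite mulr_sumr.
  transitivity (\sum_(p : 'I_n.+1 * 'I_r)
      (1 - colour A p.1 * colour A (p.1 + p.2.+1))).
    rewrite sumrB sumr_const card_prod !card_ord natrM mulrC; congr (_ - _).
    rewrite big_add1 big_mkord -(pair_bigA _ (fun (i : 'I_n.+1) (k : 'I_r) =>
      colour A i * colour A (i + k.+1))) exchange_big /=.
    by apply: eq_bigr => k _; rewrite /corr big_mkord.
  apply: eq_bigr => -[i k] _; rewrite /colour /nxt /= modn_small // inord_val.
  by case: (_ \in A); case: (_ \in A).
rewrite ler_pM2l // ler_nat.
exact: leq_trans (subset_leq_card cutB) (leq_imset_card _ _).
Qed.

Theorem lemma12 (n r : nat) (hn : (0 < n)%N) (hr : (0 < r)%N) :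
  (maxcut (@circulant n r))%:R <= (5%:R * r%:R / 8%:R + 76%:R) * n%:R :> rat.
Proof.
case: n hn => // n _.
have main : (8 * maxcut (@circulant n.+1 r) <= (5 * r + 82) * n.+1)%N.
  rewrite mulnC -leq_divRL //; apply/bigmax_leqP => A _; rewrite leq_divRL //.
  have := card_cut_le r A.
  have := corr_sum_ge r (colour_periodic A) (colour_sqr A); lia.
move: main; rewrite -(ler_nat rat) !natrM natrD natrM => main.
have : 0 <= n.+1%:R :> rat by []; lra.
Qed.
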